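(* Let $R$ be an integral domain and let $D$ be a $t$-compatible overring of $R$ which is a Mori domain. If $R$ is Clifford $t$-regular (respectively, Boole $t$-regular, $t$-stable, strongly $t$-stable), then $D$ is Clifford $t_D$-regular (respectively, Boole $t_D$-regular, $t_D$-stable, strongly $t_D$-stable).
   Context: Let $R$ be an integral domain with field of fractions $K$. An overring of $R$ is a ring $D$ with $R\subseteq D\subseteq K$. An ideal of $R$ means a nonzero fractional ideal; it is integral if it is contained in $R$. For $R$-submodules $I,J$ of $K$, $(J:I):=\{x\in K: xI\subseteq J\}$, and $E(I):=(I:I)$. For an ideal $I$, $I^v:=(R:(R:I))$ and $I^t:=\bigcup\{J^v : J\subseteq I \text{ a finitely generated ideal of } R\}$. For an overring $D$, $t_D$ denotes the $t$-operation of the domain $D$ (computed with $D$ in place of $R$). $D$ is $t$-compatible over $R$ if $(ID)^{t_D}=(I^tD)^{t_D}$ for each ideal $I$ of $R$. A domain is Mori if it satisfies the ascending chain condition on integral divisorial ideals ($I=I^v$) (equivalently, on integral $t$-ideals, i.e. those with $I=I^t$). An ideal $I$ of $R$ is: (Clifford) $t$-regular if $I^t=(I^2J)^t$ for some ideal $J$ of $R$; Boole $t$-regular if $(I^2)^t=xI^t$ for some $0\neq x\in K$; $t$-stable if, with $E:=E(I^t)$, $(I^t(E:I^t))^t=E$ ($t$ being the $t$-operation of $R$; fractional ideals of $E$ are fractional ideals of $R$); strongly $t$-stable if $I^t=xE(I^t)$ for some $x\in K$. The domain $R$ is Clifford $t$-regular (respectively Boole $t$-regular, $t$-stable, strongly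 $t$-stable) if every ideal of $R$ has the corresponding property. The same definitions apply to $D$ with the operation $t_D$. *)

(* Defs.v *)
From mathcomp Require Import all_boot all_algebra.
From mathcomp Require Import boolp classical_sets.

Set Implicit Arguments.
Unset Strict Implicit.
Unset Printing Implicit Defensive.

Import GRing.Theory.
Local Open Scope ring_scope.
Local Open Scope classical_set_scope.

(* All rings and modules live inside a fixed field K and are represented as
   subsets of K.  A domain A with field of fractions K is a subset of K, so that
   the same definitions serve for a domain and for its overrings. *)

Section Submodules.
Variable K : fieldType.
Implicit Types (A D I J : set K) (x : K).

(* The additive subgroup generated by the products i * j (i in I, j in J): it is
   the product of ideals when I and J are ideals, and the A-module generated by
   I when J is a ring A. *)
Definition mulset I J : set K :=
  [set x | exists s : seq (K * K),
     (forall p, p \in s -> I p.1 /\ J p.2) /\ x = \sum_(p <- s) p.1 * p.2].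

Definition scaleset x I : set K := [set x * y | y in I].

(* (J : I) *)
Definition colon J I : set K := [set x | forall y, I y -> J (x * y)].

Definition endo I : set K := colon I I.

Record ideal A I : Prop := Ideal {
  ideal_add : forall x y, I x -> I y -> I (x + y);
  ideal_mul : forall a x, A a -> I x -> I (a * x);
  ideal_neq0 : exists x, I x /\ x != 0;
  ideal_denom : exists d, [/\ A d, d != 0 & scaleset d I `<=` A]
}.

Definition fg_ideal A J : Prop :=
  ideal A J /\ exists s : seq K, J = mulset [set` s] A.

Definition v_op A I : set K := colon A (colon A I).

Definition t_op A I : set K :=
  [set x | exists J, [/\ fg_ideal A J, J `<=` I & v_op A J x]].

Definition overring A D : Prop :=
  GRing.subring_closed (mem D) /\ A `<=` D.

Definition t_compatible A D : Prop :=
  forall I, ideal A I -> t_op D (mulset I D) = t_op D (mulset (t_op A I) D).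

Definition mori A : Prop :=
  forall I : nat -> set K,
    (forall n, [/\ ideal A (I n), I n `<=` A & v_op A (I n) = I n]) ->
    (forall n, I n `<=` I n.+1) ->
    exists N, forall n, (N <= n)%N -> I n = I N.

Definition clifford_t_regular_ideal A I : Prop :=
  exists J, ideal A J /\ t_op A I = t_op A (mulset (mulset I I) J).

Definition boole_t_regular_ideal A I : Prop :=
  exists x, x != 0 /\ t_op A (mulset I I) = scaleset x (t_op A I).

(* The outer t-operation is that of A, not that of E. *)
Definition t_stable_ideal A I : Prop :=
  let E := endo (t_op A I) in
  t_op A (mulset (t_op A I) (colon E (t_op A I))) = E.

Definition strongly_t_stable_ideal A I : Prop :=
  exists x, t_op A I = scaleset x (endo (t_op A I)).

Definition clifford_t_regular A : Prop :=
  forall I, ideal A I -> clifford_t_regular_ideal A I.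

Definition boole_t_regular A : Prop :=
  forall I, ideal A I -> boole_t_regular_ideal A I.

Definition t_stable A : Prop :=
  forall I, ideal A I -> t_stable_ideal A I.

Definition strongly_t_stable A : Prop :=
  forall I, ideal A I -> strongly_t_stable_ideal A I.

End Submodules.

(* R, as a subset of its field of fractions. *)
Definition base_ring (R : idomainType) : set {fraction R} :=
  range (@FracField.tofrac R).
Arguments base_ring R : clear implicits.

(* Main.v *)
Require Import Defs.
From mathcomp Require Import all_boot all_algebra.
From mathcomp Require Import boolp classical_sets.

(** In a Mori domain D every ideal J has the same t-closure as some finitely
    generated F = (f_1, ..., f_n)D contained in J, and F = ID for the finitely
    generated R-ideal I = (f_1, ..., f_n)R.  Each of the four conditions on J only
    depends on the t-closure of J, so it may be checked on ID; there it follows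
    from the corresponding identity for I by extending to D and taking t-closures
    over D, t-compatibility absorbing the t-closures over R. *)

Set Implicit Arguments.
Unset Strict Implicit.
Unset Printing Implicit Defensive.

Import GRing.Theory.
Local Open Scope ring_scope.
Local Open Scope classical_set_scope.

(** * Products and spans *)

Section Products.
Variable K : fieldType.
Implicit Types (A D I J X Y Z : set K) (x : K) (s : seq K).

Lemma mulset_in I J x y : I x -> J y -> mulset I J (x * y).
Proof.
move=> Ix Jy; exists [:: (x, y)]; rewrite big_seq1; split => // p.
by rewrite inE => /eqP ->.
Qed.

Lemma mulset0 I J : mulset I J 0.
Proof. by exists [::]; rewrite big_nil. Qed.

Lemma mulsetD I J x y : mulset I J x -> mulset I J y -> mulset I J (x + y).
Proof.
move=> [s [hs ->]] [r [hr ->]]; exists (s ++ r); rewrite big_cat; split => // p.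
by rewrite mem_cat => /orP [/hs | /hr].
Qed.

Lemma mulset_min I J X : X 0 -> (forall x y, X x -> X y -> X (x + y)) ->
  (forall x y, I x -> J y -> X (x * y)) -> mulset I J `<=` X.
Proof.
move=> X0 XD XM _ [s [hs ->]]; elim: s hs => [|p s IHs] hs; first by rewrite big_nil.
rewrite big_cons; apply: XD; last by apply: IHs => q qs; apply: hs; rewrite inE qs orbT.
by have [Ip Jp] := hs p (mem_head _ _); apply: XM.
Qed.

(** Induction on [mulset I J] under a fixed multiplier [c], so that statements about products of two
    such sets can be proved one factor at a time. *)
Lemma mulset_minZ c I J X : X 0 -> (forall x y, X x -> X y -> X (x + y)) ->
  (forall x y, I x -> J y -> X (c * (x * y))) ->
  forall x, mulset I J x -> X (c * x).
Proof.
move=> X0 XD XM; apply: mulset_min => /=; first by rewrite mulr0.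
  by move=> x y hx hy; rewrite mulrDr; apply: XD.
exact: XM.
Qed.

Lemma mulsetS I I' J J' : I `<=` I' -> J `<=` J' -> mulset I J `<=` mulset I' J'.
Proof.
move=> II' JJ'; apply: mulset_min; [exact: mulset0 | exact: mulsetD |].
by move=> x y /II' I'x /JJ' J'y; apply: mulset_in.
Qed.

Lemma mulset_mull A I J a x : (forall b y, A b -> I y -> I (b * y)) ->
  A a -> mulset I J x -> mulset I J (a * x).
Proof.
move=> IM Aa; move: x; apply: mulset_minZ; [exact: mulset0 | exact: mulsetD |].
by move=> x y Ix Jy; rewrite mulrA; apply: mulset_in => //; apply: IM.
Qed.

Lemma mulset_mulr A I J a x : (forall b y, A b -> J y -> J (b * y)) ->
  A a -> mulset I J x -> mulset I J (a * x).
Proof.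
move=> JM Aa; move: x; apply: mulset_minZ; [exact: mulset0 | exact: mulsetD |].
by move=> x y Ix Jy; rewrite mulrCA; apply: mulset_in => //; apply: JM.
Qed.

Lemma mulset_scale c I J : mulset (scaleset c I) J = scaleset c (mulset I J).
Proof.
apply/seteqP; split.
- apply: mulset_min.
  + by exists 0; [exact: mulset0 | rewrite mulr0].
  + move=> _ _ [x hx <-] [y hy <-]; exists (x + y); last by rewrite mulrDr.
    exact: mulsetD.
  + move=> _ y [x Ix <-] Jy; exists (x * y); last by rewrite mulrA.
    exact: mulset_in.
- move=> _ [x hx <-]; move: x hx.
  apply: mulset_minZ; [exact: mulset0 | exact: mulsetD |] => x y Ix Jy.
  by rewrite mulrA; apply: mulset_in => //; exists x.
Qed.

End Products.

(** * Ideals of a domain inside its field of fractions *)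

Section Domain.
Variables (K : fieldType) (A : set K).

(** [fsub_frac] says that [K] is the field of fractions of [A]. The base ring and its overrings all
    satisfy this record, so one theory serves both. *)
Record frac_subring : Prop := FracSubring {
  fsub1 : A 1;
  fsubB : forall x y, A x -> A y -> A (x - y);
  fsubM : forall x y, A x -> A y -> A (x * y);
  fsub_frac : forall x, exists d, [/\ A d, d != 0 & A (d * x)]
}.

Hypothesis domA : frac_subring.
Implicit Types (I J X Y Z : set K) (x : K) (s : seq K).
Local Notation span s := (mulset [set` s] A).

Lemma fsub0 : A 0.
Proof. by rewrite -(subrr 1); apply: (fsubB domA); apply: fsub1. Qed.

Lemma fsubD x y : A x -> A y -> A (x + y).
Proof.
move=> Ax Ay; rewrite -[y]opprK -[- y]sub0r; do 2!apply: (fsubB domA) => //.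
exact: fsub0.
Qed.

Lemma ideal0 I : ideal A I -> I 0.
Proof.
move=> idI; have [x [Ix _]] := ideal_neq0 idI; rewrite -(mul0r x).
by apply: (ideal_mul idI) => //; apply: fsub0.
Qed.

Lemma ideal_self : ideal A A.
Proof.
split; [exact: fsubD | exact: (fsubM domA) | |].
- by exists 1; split; [apply: fsub1 | apply: oner_neq0].
- by exists 1; split; [apply: fsub1 | apply: oner_neq0 |] => // _ [x Ax <-]; rewrite mul1r.
Qed.

Lemma mulset_min_ideal I J X : ideal A X ->
  (forall x y, I x -> J y -> X (x * y)) -> mulset I J `<=` X.
Proof.
by move=> idX h; apply: mulset_min; [apply: ideal0 | exact: (ideal_add idX) |].
Qed.

Lemma mulset_minZ_ideal c I J X : ideal A X ->
  (forall x y, I x -> J y -> X (c * (x * y))) ->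
  forall x, mulset I J x -> X (c * x).
Proof.
by move=> idX h; apply: mulset_minZ; [apply: ideal0 | exact: (ideal_add idX) |].
Qed.

Lemma ideal_mulset I J : ideal A I -> ideal A J -> ideal A (mulset I J).
Proof.
move=> idI idJ; split.
- by move=> *; apply: mulsetD.
- by move=> a x; apply: mulset_mull => b y; apply: ideal_mul.
- have [x [Ix x0]] := ideal_neq0 idI; have [y [Jy y0]] := ideal_neq0 idJ.
  by exists (x * y); rewrite mulf_neq0 //; split => //; apply: mulset_in.
- have [d [Ad d0 dI]] := ideal_denom idI; have [e [Ae e0 eJ]] := ideal_denom idJ.
  exists (d * e); rewrite mulf_neq0 //; split => //; first exact: (fsubM domA).
  move=> _ [x + <-]; move: x; apply: mulset_minZ_ideal ideal_self _ => x y Ix Jy.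
  by rewrite mulrACA; apply: (fsubM domA); [apply: dI; exists x | apply: eJ; exists y].
Qed.

Lemma ideal_scaleset c I : c != 0 -> ideal A I -> ideal A (scaleset c I).
Proof.
move=> c0 idI; split.
- move=> _ _ [x Ix <-] [y Iy <-]; exists (x + y); last by rewrite mulrDr.
  exact: (ideal_add idI).
- move=> a _ Aa [x Ix <-]; exists (a * x); last by rewrite mulrCA.
  exact: (ideal_mul idI).
- have [x [Ix x0]] := ideal_neq0 idI.
  by exists (c * x); rewrite mulf_neq0 //; split => //; exists x.
- have [d [Ad d0 dI]] := ideal_denom idI; have [e [Ae e0 Aec]] := fsub_frac domA c.
  exists (d * e); rewrite mulf_neq0 //; split => //; first exact: (fsubM domA).
  move=> _ [_ [x Ix <-] <-].
  by rewrite [d * e]mulrC mulrACA; apply: (fsubM domA) => //; apply: dI; exists x.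
Qed.

Lemma ideal_colon I J : ideal A I -> ideal A J -> ideal A (colon J I).
Proof.
move=> idI idJ; split.
- by move=> x y hx hy z Iz; rewrite mulrDl; apply: (ideal_add idJ); [apply: hx | apply: hy].
- by move=> a x Aa hx z Iz; rewrite -mulrA; apply: (ideal_mul idJ) => //; apply: hx.
- have [d [Ad d0 dI]] := ideal_denom idI; have [y [Jy y0]] := ideal_neq0 idJ.
  exists (d * y); rewrite mulf_neq0 //; split => // z Iz.
  by rewrite mulrAC; apply: (ideal_mul idJ) => //; apply: dI; exists z.
(* For [x] in the colon, [x * y] lies in [J], so [d * y] multiplies [x] into [A]; the factor [e]
   brings this denominator itself into [A]. *)
- have [y [Iy y0]] := ideal_neq0 idI; have [d [Ad d0 dJ]] := ideal_denom idJ.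
  have [e [Ae e0 Aey]] := fsub_frac domA y.
  exists (d * (e * y)); rewrite !mulf_neq0 //; split => //; first exact: (fsubM domA).
  move=> _ [x hx <-].
  rewrite (_ : _ * x = e * (d * (x * y))).
    by apply: (fsubM domA) => //; apply: dJ; exists (x * y) => //; apply: hx.
  by rewrite mulrCA -!mulrA [y * x]mulrC.
Qed.

Lemma ideal_endo I : ideal A I -> ideal A (endo I).
Proof. by move=> idI; apply: ideal_colon. Qed.

Lemma span_sub s X : ideal A X -> (forall z, z \in s -> X z) -> span s `<=` X.
Proof.
move=> idX sX; apply: mulset_min_ideal => // x a /sX Xx Aa.
by rewrite mulrC; apply: (ideal_mul idX).
Qed.

Lemma span_in s z : z \in s -> span s z.
Proof. by move=> zs; rewrite -[z]mulr1; apply: mulset_in => //; apply: fsub1. Qed.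

Lemma seq_denom s : exists d, [/\ A d, d != 0 & forall z, z \in s -> A (d * z)].
Proof.
elim: s => [|x s [d [Ad d0 ds]]].
  by exists 1; split; [apply: fsub1 | apply: oner_neq0 |].
have [e [Ae e0 Aex]] := fsub_frac domA x.
exists (d * e); rewrite mulf_neq0 //; split => //; first exact: (fsubM domA).
move=> z; rewrite inE => /orP [/eqP -> | /ds Adz].
  by rewrite -mulrA; apply: (fsubM domA).
by rewrite mulrAC mulrC; apply: (fsubM domA).
Qed.

Lemma ideal_span s x : x \in s -> x != 0 -> ideal A (span s).
Proof.
move=> xs x0; split.
- by move=> *; apply: mulsetD.
- by move=> a y; apply: mulset_mulr => b z; apply: fsubM.
- by exists x; split => //; apply: span_in.
- have [d [Ad d0 ds]] := seq_denom s; exists d; split => // _ [y + <-]; move: y.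
  apply: mulset_minZ_ideal ideal_self _ => y z /ds Ady Az.
  by rewrite mulrA; apply: (fsubM domA).
Qed.

Lemma ideal_span_neq0 s : ideal A (span s) -> exists2 x, x \in s & x != 0.
Proof.
move=> idS; have [y [hy y0]] := ideal_neq0 idS; apply: contrapT => s0.
have : [set 0] y.
  apply: mulset_min hy => // [u v -> ->|u v us _] /=; first by rewrite addr0.
  have [->|u0] := eqVneq u 0; first by rewrite mul0r.
  by case: s0; exists u.
by move/eqP: y0.
Qed.

(** * The v- and t-operations *)

(** If [c I] lies in [J^v], then any [y] in [(A : J)] has [c y] in [(A : I)], whence
    [(c x) y = x (c y)] lies in [A]. *)
Lemma v_op_scale c I J : (forall z, I z -> v_op A J (c * z)) ->
  forall x, v_op A I x -> v_op A J (c * x).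
Proof.
move=> cI x hx y hy; rewrite -mulrA mulrCA; apply: hx => z Iz.
by rewrite mulrAC; apply: cI.
Qed.

Lemma v_op_in I : I `<=` v_op A I.
Proof. by move=> x Ix y hy; rewrite mulrC; apply: hy. Qed.

Lemma v_opS I J : I `<=` v_op A J -> v_op A I `<=` v_op A J.
Proof.
by move=> IJ x hx; rewrite -[x]mul1r; apply: v_op_scale hx => z /IJ; rewrite mul1r.
Qed.

Lemma v_op_idem I : v_op A (v_op A I) = v_op A I.
Proof. by apply/seteqP; split; [apply: v_opS | apply: v_op_in]. Qed.

Lemma v_op_integral I : I `<=` A -> v_op A I `<=` A.
Proof. by move=> IA x hx; rewrite -[x]mulr1; apply: hx => y /IA; rewrite mul1r. Qed.

Lemma ideal_v I : ideal A I -> ideal A (v_op A I).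
Proof.
by move=> idI; apply: ideal_colon ideal_self; apply: ideal_colon ideal_self.
Qed.

Lemma t_op_in I : ideal A I -> I `<=` t_op A I.
Proof.
(* Ideals are nonzero and [x] may be [0], so a nonzero [y] is added as a second generator. *)
move=> idI x Ix; have [y [Iy y0]] := ideal_neq0 idI.
have idS : ideal A (span [:: x; y]) by apply: (@ideal_span _ y); rewrite ?inE ?eqxx ?orbT.
exists (span [:: x; y]); split.
- by split => //; exists [:: x; y].
- by apply: span_sub => // z; rewrite !inE => /orP [] /eqP ->.
- by apply: v_op_in; apply: span_in; rewrite inE eqxx.
Qed.

(** The union defining the t-closure is directed: concatenating generator lists puts finitely many
    elements into the v-closure of a single finitely generated ideal. *)
Lemma t_op_seq I s : ideal A I -> (forall z, z \in s -> t_op A I z) ->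
  exists F, [/\ fg_ideal A F, F `<=` I & forall z, z \in s -> v_op A F z].
Proof.
move=> idI; elim: s => [|x s IHs] hs.
  have [y [Iy y0]] := ideal_neq0 idI.
  have idS : ideal A (span [:: y]) by apply: ideal_span y0; rewrite inE.
  exists (span [:: y]); split => //; first by split => //; exists [:: y].
  by apply: span_sub => // z; rewrite inE => /eqP ->.
have [|F [[idF [r FE]]]] := IHs.
  by move=> z zs; apply: hs; rewrite inE zs orbT.
rewrite FE in idF * => rI hr.
have [G [[_ [q ->]] qI hq]] := hs x (mem_head _ _).
have subr : span r `<=` span (r ++ q).
  by apply: mulsetS => // z /= zr; rewrite mem_cat zr.
have subq : span q `<=` span (r ++ q).
  by apply: mulsetS => // z /= zq; rewrite mem_cat zq orbT.
have idS : ideal A (span (r ++ q)).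
  have [y yr y0] := ideal_span_neq0 idF.
  by apply: ideal_span y0; rewrite mem_cat yr.
exists (span (r ++ q)); split => //.
- by split => //; exists (r ++ q).
- apply: span_sub => // z; rewrite mem_cat => /orP [zr | zq].
    by apply: rI; apply: span_in.
  by apply: qI; apply: span_in.
- move=> z; rewrite inE => /orP [/eqP -> | /hr hz].
    by apply: (@v_opS (span q)) => // y /subq; apply: v_op_in.
  by apply: (@v_opS (span r)) => // y /subr; apply: v_op_in.
Qed.

(* With c = 1 this is minimality of the t-closure; letting c vary also gives
   compatibility with products and the t-closedness of colons of t-ideals. *)
Lemma t_op_scale c I J : ideal A J -> (forall z, I z -> t_op A J (c * z)) ->
  forall x, t_op A I x -> t_op A J (c * x).
Proof.
move=> idJ cI x [F [[_ [s FE]] sI hx]].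
(* The images under [c] of the finitely many generators of [F] all lie in one [G^v], hence so does
   [c F^v]. *)
have [|G [fgG GJ hG]] := @t_op_seq J [seq c * z | z <- s] idJ.
  by move=> _ /mapP [z zs ->]; apply/cI/sI; rewrite FE; apply: span_in.
exists G; split => //; apply: v_op_scale hx.
have idG := ideal_v (proj1 fgG); rewrite FE; apply: mulset_minZ_ideal => // y a ys Aa.
rewrite mulrA mulrC; apply: (ideal_mul idG) => //.
by apply: hG; apply: map_f.
Qed.

Lemma t_op_min I J : ideal A J -> I `<=` t_op A J -> t_op A I `<=` t_op A J.
Proof.
by move=> idJ IJ x hx; rewrite -[x]mul1r; apply: t_op_scale hx => // z /IJ; rewrite mul1r.
Qed.

Lemma t_opS I J : I `<=` J -> t_op A I `<=` t_op A J.
Proof. by move=> IJ x [F [fgF FI hx]]; exists F; split => // y /FI /IJ. Qed.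

Lemma ideal_t I : ideal A I -> ideal A (t_op A I).
Proof.
move=> idI; split.
- move=> x y hx hy; have [||F [fgF FI hF]] := @t_op_seq I [:: x; y] => //.
    by move=> z; rewrite !inE => /orP [] /eqP ->.
  exists F; split => //; apply: (ideal_add (ideal_v (proj1 fgF))); apply: hF.
    by rewrite inE eqxx.
  by rewrite !inE eqxx orbT.
- move=> a x Aa; apply: t_op_scale => // z Iz; apply: t_op_in => //.
  exact: (ideal_mul idI).
- by have [x [Ix x0]] := ideal_neq0 idI; exists x; split => //; apply: t_op_in.
(* A denominator [d] of [I] also serves for its t-closure: [d] lies in [(A : F)] for each [F] inside
   [I], so [F^v] multiplies it into [A]. *)
- have [d [Ad d0 dI]] := ideal_denom idI; exists d; split => // _ [x [F [_ FI hx]] <-].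
  rewrite mulrC; apply: hx => y /FI Iy.
  by apply: dI; exists y.
Qed.

Lemma t_op_idem I : ideal A I -> t_op A (t_op A I) = t_op A I.
Proof.
move=> idI; apply/seteqP; split; first exact: t_op_min.
exact/t_op_in/ideal_t.
Qed.

(** [t_op_scale] is applied twice, once in each factor with the other held fixed. *)
Lemma t_op_mulset I J Z : ideal A Z ->
  (forall x y, I x -> J y -> t_op A Z (x * y)) ->
  forall x y, t_op A I x -> t_op A J y -> t_op A Z (x * y).
Proof.
move=> idZ h x y hx; apply: t_op_scale => // z Jz; rewrite mulrC.
by apply: t_op_scale hx => // u Iu; rewrite mulrC; apply: h.
Qed.

Lemma t_op_mulset_sub I I' J J' : ideal A I' -> ideal A J' ->
  I `<=` t_op A I' -> J `<=` t_op A J' ->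
  t_op A (mulset I J) `<=` t_op A (mulset I' J').
Proof.
move=> idI' idJ' hI hJ; have idIJ := ideal_mulset idI' idJ'.
apply: t_op_min => //; apply: mulset_min_ideal; first exact: ideal_t.
move=> x y /hI hx /hJ hy; apply: t_op_mulset hx hy => // u v Iu Jv.
by apply: t_op_in => //; apply: mulset_in.
Qed.

Lemma eq_t_op_mulset I I' J J' :
  ideal A I -> ideal A I' -> ideal A J -> ideal A J' ->
  t_op A I = t_op A I' -> t_op A J = t_op A J' ->
  t_op A (mulset I J) = t_op A (mulset I' J').
Proof.
move=> idI idI' idJ idJ' eI eJ; apply/seteqP; split; apply: t_op_mulset_sub => //.
- by rewrite -eI; apply: t_op_in.
- by rewrite -eJ; apply: t_op_in.
- by rewrite eI; apply: t_op_in.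
- by rewrite eJ; apply: t_op_in.
Qed.

Lemma t_op_scaleset c I : c != 0 -> ideal A I ->
  t_op A (scaleset c I) = scaleset c (t_op A I).
Proof.
move=> c0 idI; have idcI := ideal_scaleset c0 idI; apply/seteqP; split.
- move=> x hx; exists (c^-1 * x); last by rewrite mulVKf.
  by apply: t_op_scale hx => // _ [y Iy <-]; rewrite mulKf //; apply: t_op_in.
- move=> _ [x hx <-]; apply: t_op_scale hx => // y Iy.
  by apply: t_op_in => //; exists y.
Qed.

(** Multiplication by [y] in [I] sends the colon into [J]; as [J] is t-closed, it sends the
    t-closure of the colon there too. *)
Lemma t_op_colon I J : ideal A I -> ideal A J -> t_op A J = J ->
  t_op A (colon J I) = colon J I.
Proof.
move=> idI idJ tJ; apply/seteqP; split; last exact/t_op_in/ideal_colon.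
move=> x hx y Iy; rewrite -tJ mulrC; apply: t_op_scale hx => // z hz.
by rewrite mulrC tJ; apply: hz.
Qed.

Lemma endo1 I : endo I 1.
Proof. by move=> x Ix; rewrite mul1r. Qed.

(* Otherwise, choosing generators one after the other outside the divisorial
   closure of the previous ones gives a strictly increasing chain. *)
Lemma mori_fg I : mori A -> ideal A I ->
  exists s, [/\ ideal A (span s), span s `<=` I & t_op A I = t_op A (span s)].
Proof.
move=> morA idI; have [x0 [Ix0 x0N0]] := ideal_neq0 idI.
suff [s [sI x0s Is]] : exists s, [/\ forall z, z \in s -> I z, x0 \in s &
    I `<=` v_op A (span s)].
  have idS := ideal_span x0s x0N0; exists s; split => //; first exact: span_sub.
  have vt : v_op A (span s) `<=` t_op A (span s).
    by move=> x hx; exists (span s); split => //; split => //; exists s.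
  apply/seteqP; split; last by apply: t_opS; apply: span_sub.
  by apply: t_op_min => // x /Is /vt.
apply: contrapT => noS.
(* The conditions on [s] stand under the existential so that every list has a value and [choice]
   yields a total function; [0] is the dummy value for the other lists. *)
have step s : exists x, (forall z, z \in s -> I z) -> x0 \in s ->
    I x /\ ~ v_op A (span s) x.
  apply: contrapT => hN; apply: noS; exists s.
  have hs : (forall z, z \in s -> I z) /\ x0 \in s.
    by apply: contrapT => h; apply: hN; exists 0 => sI x0s; case: h.
  case: hs => sI x0s; split => // x Ix; apply: contrapT => hx.
  by apply: hN; exists x.
have [f hf] := choice step.
pose u n := iter n (fun s => f s :: s) [:: x0].
have hu n : (forall z, z \in u n -> I z) /\ x0 \in u n.
  elim: n => [|n [uI x0u]]; first by split => [z|]; rewrite inE // => /eqP ->.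
  have [Ifu _] := hf _ uI x0u; split; last by rewrite inE x0u orbT.
  by move=> z; rewrite inE => /orP [/eqP -> | /uI].
have idU n : ideal A (span (u n)) by apply: (@ideal_span _ x0) => //; case: (hu n).
(* The Mori condition concerns integral ideals, so the chain is scaled into [A] by a denominator of
   [I]. *)
have [d [Ad d0 dI]] := ideal_denom idI.
have idV n := ideal_scaleset d0 (idU n).
have [||N hN] := morA (fun n => v_op A (scaleset d (span (u n)))).
- move=> n; split; [exact: ideal_v | | exact: v_op_idem].
  apply: v_op_integral => _ [x hx <-]; apply: dI; exists x => //.
  by apply: span_sub hx => //; case: (hu n).
- move=> n; apply: v_opS => _ [x hx <-]; apply: v_op_in; exists x => //.
  by apply: mulsetS hx => // z /= zu; rewrite inE zu orbT.
have [uI x0u] := hu N; have [_ []] := hf _ uI x0u.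
(* Stabilisation puts [d * f (u N)] in the [N]-th closure; dividing by [d] contradicts the choice of
   [f (u N)]. *)
rewrite -[f _](mulKf d0).
apply: (@v_op_scale _ (scaleset d (span (u N)))) => [_ [z hz <-]|].
  by rewrite mulKf //; apply: v_op_in.
rewrite -(hN N.+1) //; apply: v_op_in; exists (f (u N)) => //.
by apply: span_in; rewrite inE eqxx.
Qed.

End Domain.

(** * Extension to an overring *)

Section Extension.
Variables (K : fieldType) (A D : set K).
Hypotheses (domA : frac_subring A) (domD : frac_subring D) (AD : A `<=` D).
Hypothesis comp : t_compatible A D.
Implicit Types (I J : set K).
Local Notation ext I := (mulset I D).

Lemma ideal_ext I : ideal A I -> ideal D (ext I).
Proof.
move=> idI; split.
- by move=> *; apply: mulsetD.
- by move=> a x; apply: mulset_mulr => b y; apply: fsubM.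
- have [x [Ix x0]] := ideal_neq0 idI; exists x; split => //.
  by rewrite -[x]mulr1; apply: mulset_in => //; apply: fsub1.
- have [d [Ad d0 dI]] := ideal_denom idI; exists d; split => //; first exact: AD.
  rewrite -mulset_scale; apply: (mulset_min_ideal domD (ideal_self domD)).
  by move=> x y /dI /AD Dx Dy; apply: (fsubM domD).
Qed.

Lemma ext_in I : I `<=` ext I.
Proof. by move=> x Ix; rewrite -[x]mulr1; apply: mulset_in => //; apply: fsub1. Qed.

Lemma ext_mulset I J : ideal A I -> ideal A J ->
  mulset (ext I) (ext J) = ext (mulset I J).
Proof.
move=> idI idJ; have idIJ := ideal_ext (ideal_mulset domA idI idJ).
apply/seteqP; split.
- apply: (mulset_min_ideal domD idIJ) => x y hx hy; rewrite mulrC; move: x hx.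
  apply: (mulset_minZ_ideal domD idIJ) => x a Ix Da.
  rewrite mulrC -mulrA mulrCA; apply: (ideal_mul idIJ) => //; move: y hy.
  apply: (mulset_minZ_ideal domD idIJ) => y b Jy Db.
  by rewrite mulrA; apply: mulset_in => //; apply: mulset_in.
- have idM := ideal_mulset domD (ideal_ext idI) (ideal_ext idJ).
  apply: (mulset_min_ideal domD idM) => x a hx Da; rewrite mulrC; apply: (ideal_mul idM) => //.
  by apply: mulsetS hx; apply: ext_in.
Qed.

(** [I^t] lies in [(I^t D)^{t_D}], which t-compatibility identifies with [(ID)^{t_D}]. *)
Lemma t_op_ext_sub I : ideal A I -> t_op A I `<=` t_op D (ext I).
Proof.
move=> idI x hx; rewrite comp //; apply: t_op_in => //; last exact: ext_in.
exact/ideal_ext/ideal_t.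
Qed.

Lemma eq_t_op_ext I J : ideal A I -> ideal A J -> t_op A I = t_op A J ->
  t_op D (ext I) = t_op D (ext J).
Proof. by move=> idI idJ eIJ; rewrite comp // eIJ -comp. Qed.

(** An endomorphism [x] of [I^t] sends [I] into [I^t], hence [ID] into the [D]-module [(ID)^{t_D}],
    and then also the t-closure of [ID]. *)
Lemma endo_t_op_ext I : ideal A I -> endo (t_op A I) `<=` endo (t_op D (ext I)).
Proof.
move=> idI x hx; apply: t_op_scale => //; first exact: ideal_ext.
have tid : ideal D (t_op D (ext I)) by apply/ideal_t/ideal_ext.
apply: (mulset_minZ_ideal domD tid) => y a Iy Da.
rewrite mulrA mulrC; apply: (ideal_mul tid) => //.
by apply: t_op_ext_sub => //; apply: hx; apply: t_op_in.
Qed.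

Hypothesis morD : mori D.

Lemma mori_ext J : ideal D J ->
  exists I, ideal A I /\ t_op D J = t_op D (ext I).
Proof.
move=> idJ; have [s [idS _ ->]] := mori_fg domD morD idJ.
have [x xs x0] := ideal_span_neq0 idS.
have idI : ideal A (mulset [set` s] A) by exact: ideal_span xs x0.
exists (mulset [set` s] A); split => //; congr t_op; apply/seteqP; split.
- by apply: mulsetS => // z zs; apply: span_in.
- apply: (mulset_min_ideal domD idS) => y a hy Da; rewrite mulrC; apply: (ideal_mul idS) => //.
  exact: mulsetS hy.
Qed.

(** * Transfer of the four regularity conditions to the overring *)

Lemma clifford_t_regular_overring : clifford_t_regular A -> clifford_t_regular D.
Proof.
move=> regA J idJ; have [I [idI eJ]] := mori_ext idJ; have idF := ideal_ext idI.
have [L [idL eI]] := regA I idI; have idG := ideal_ext idL.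
have idII := ideal_mulset domA idI idI.
exists (ext L); split => //.
(* Once [J] is replaced by [ID], the right side is the t-closure of [(I^2 L)D], and [I], [I^2 L]
   have the same t-closure over [A]. *)
rewrite [RHS](@eq_t_op_mulset _ _ domD _ (mulset (ext I) (ext I)) _ (ext L)) //.
- rewrite !ext_mulset // eJ; apply: eq_t_op_ext => //; exact: ideal_mulset.
- exact: ideal_mulset.
- exact: ideal_mulset.
- exact: eq_t_op_mulset.
Qed.

(** The same [x] works: [(I^2 D)^{t_D} = ((I^2)^t D)^{t_D} = (x I^t D)^{t_D} = x (ID)^{t_D}]. *)
Lemma boole_t_regular_overring : boole_t_regular A -> boole_t_regular D.
Proof.
move=> regA J idJ; have [I [idI eJ]] := mori_ext idJ; have idF := ideal_ext idI.
have [x [x0 eI]] := regA I idI; exists x; split => //.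
have idtI := ideal_t domA idI.
rewrite (@eq_t_op_mulset _ _ domD _ (ext I) _ (ext I)) // ext_mulset //.
rewrite comp; last exact: ideal_mulset.
rewrite eI mulset_scale t_op_scaleset //; last exact: ideal_ext.
by rewrite -comp // eJ.
Qed.

(** The product lies in the t-closed endomorphism ring of [(ID)^{t_D}], so it remains to find [1] in
    its t-closure; this is inherited from stability of [I]. *)
Lemma t_stable_overring : t_stable A -> t_stable D.
Proof.
move=> stA J idJ; have [I [idI eJ]] := mori_ext idJ; have idF := ideal_ext idI.
have := stA I idI; rewrite /t_stable_ideal /= eJ.
set T := t_op A I; set E := endo T; set M := colon E T.
set U := t_op D (ext I); set E' := endo U; set M' := colon E' U => eE.
have idT : ideal A T by exact: ideal_t.
have idE : ideal A E by exact: ideal_endo.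
have idM : ideal A M by exact: ideal_colon.
have idU : ideal D U by exact: ideal_t.
have idE' : ideal D E' by exact: ideal_endo.
have idM' : ideal D M' by exact: ideal_colon.
have idUM : ideal D (mulset U M') by exact: ideal_mulset.
have tE' : t_op D E' = E' by apply: t_op_colon => //; apply: t_op_idem.
have EE' : E `<=` E' by exact: endo_t_op_ext.
(* For [m] in [M], [m I] lies in [E], hence in [E']; so [m (ID)] lies in [E'], and [m U] does
   because [E'] is t-closed over [D]. *)
have MM' : M `<=` M'.
  move=> m hm; rewrite /M' /U => y; rewrite -tE'; apply: t_op_scale => //.
  rewrite tE'; apply: (mulset_minZ_ideal domD idE') => z a Iz Da.
  rewrite mulrA mulrC; apply: (ideal_mul idE') => //.
  by apply: EE'; apply: hm; apply: t_op_in.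
have tUM1 : t_op D (mulset U M') 1.
  have : t_op A (mulset T M) 1 by rewrite eE; apply: endo1.
  move/(t_op_ext_sub (ideal_mulset domA idT idM)).
  apply: t_opS; apply: (mulset_min_ideal domD idUM) => x a hx Da.
  rewrite mulrC; apply: (ideal_mul idUM) => //.
  by apply: mulsetS hx => //; apply: t_op_ext_sub.
apply/seteqP; split.
- rewrite -[X in _ `<=` X]tE'; apply: t_op_min => //; rewrite tE'.
  by apply: (mulset_min_ideal domD idE') => x y Ux M'y; rewrite mulrC; apply: M'y.
(* [E'] maps [U] into itself, so [e] preserves [mulset U M'] and sends [1] to an element of its
   t-closure. *)
- move=> e E'e; rewrite -[e]mulr1; apply: t_op_scale tUM1 => // z hz.
  apply: t_op_in => //; apply: mulset_mull hz; last exact: E'e.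
  by move=> b y; apply.
Qed.

(** The same [x] works. One inclusion extends [I^t = xE] to [D] and uses that the new endomorphism
    ring is t-closed and contains [E]; the other uses that [x] lies in [I^t], hence in
    [(ID)^{t_D}]. *)
Lemma strongly_t_stable_overring : strongly_t_stable A -> strongly_t_stable D.
Proof.
move=> stA J idJ; have [I [idI eJ]] := mori_ext idJ; have idF := ideal_ext idI.
have [x eI] := stA I idI; exists x; rewrite eJ.
have idE : ideal A (endo (t_op A I)) by apply/ideal_endo => //; apply: ideal_t.
have idU : ideal D (t_op D (ext I)) by exact: ideal_t.
have x0 : x != 0.
  have [y []] := ideal_neq0 (ideal_t domA idI).
  by rewrite eI => -[z _ <-]; rewrite mulf_eq0 negb_or => /andP [].
have idE' := ideal_endo domD idU.
have tE' : t_op D (endo (t_op D (ext I))) = endo (t_op D (ext I)).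
  by apply: t_op_colon => //; apply: t_op_idem.
apply/seteqP; split.
- rewrite {1}comp // eI mulset_scale t_op_scaleset //; last exact: ideal_ext.
  move=> _ [y hy <-]; exists y => //; rewrite -tE'.
  apply: t_op_min hy => //; rewrite tE'.
  apply: (mulset_min_ideal domD idE') => z a /(endo_t_op_ext idI) E'z Da.
  by rewrite mulrC; apply: (ideal_mul idE').
- move=> _ [y E'y <-]; rewrite mulrC; apply: E'y; apply: t_op_ext_sub => //.
  by rewrite eI; exists 1; [apply: endo1 | rewrite mulr1].
Qed.

End Extension.

(** * The base ring and its overrings inside the fraction field *)

Section FractionField.
Variable R : idomainType.

Lemma fraction_denom (x : {fraction R}) :
  exists d, [/\ base_ring R d, d != 0 & base_ring R (d * x)].
Proof.
elim/quotW: x => x; exists (FracField.tofrac \d_x); split; first by exists \d_x.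
  by rewrite tofrac_eq0 denom_ratioP.
(* On representatives, the claim that the denominator times the fraction is the numerator becomes a
   cross-multiplication identity in [R]. *)
exists \n_x => //; unlock FracField.tofrac; rewrite -[RHS]FracField.pi_mul.
apply/eqmodP; rewrite /= FracField.equivfE /FracField.mulf.
by rewrite !numden_Ratio ?mulf_neq0 ?oner_neq0 ?denom_ratioP // !mul1r mulrC.
Qed.

Lemma frac_subring_base : frac_subring (base_ring R).
Proof.
split; last exact: fraction_denom.
- by exists 1 => //; rewrite rmorph1.
- by move=> _ _ [x _ <-] [y _ <-]; exists (x - y) => //; rewrite rmorphB.
- by move=> _ _ [x _ <-] [y _ <-]; exists (x * y) => //; rewrite rmorphM.
Qed.

Lemma frac_subring_overring (D : set {fraction R}) :
  overring (base_ring R) D -> frac_subring D.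
Proof.
move=> [[D1 DB DM] RD]; split.
- exact: set_mem.
- by move=> x y /mem_set Dx /mem_set Dy; apply/set_mem/DB.
- by move=> x y /mem_set Dx /mem_set Dy; apply/set_mem/DM.
- by move=> x; have [d [Rd d0 Rdx]] := fraction_denom x; exists d; split => //; apply: RD.
Qed.

End FractionField.

Theorem proposition2p1 (R : idomainType) (D : set {fraction R})
  (hover : overring (base_ring R) D)
  (hcomp : t_compatible (base_ring R) D)
  (hmori : mori D) :
  (clifford_t_regular (base_ring R) -> clifford_t_regular D) /\
  (boole_t_regular (base_ring R) -> boole_t_regular D) /\
  (t_stable (base_ring R) -> t_stable D) /\
  (strongly_t_stable (base_ring R) -> strongly_t_stable D).
Proof.
have domR := frac_subring_base R; have domD := frac_subring_overring hover.
have RD := hover.2.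
split; first exact: clifford_t_regular_overring.
split; first exact: boole_t_regular_overring.
split; first exact: t_stable_overring.
exact: strongly_t_stable_overring.
Qed.
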